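(* Let $(N,g)$ be a 2-step pseudo-Riemannian nilmanifold with non-degenerate centre, with Lie algebra $\mathfrak n=\mathfrak z\oplus\mathfrak v$. Let $\mathfrak z_1\subset\mathfrak z$ and $\mathfrak v_1\subset\mathfrak v$ be non-degenerate subspaces, with corresponding orthogonal decompositions $\mathfrak z=\mathfrak z_1\oplus\mathfrak z_2$ and $\mathfrak v=\mathfrak v_1\oplus\mathfrak v_2$. Then the following assertions hold: 1) If $J_Z(\mathfrak v_1)\subset\mathfrak v_2$ for any $Z\in\mathfrak z_2$, then $\mathfrak n_1:=\mathfrak z_1\oplus\mathfrak v_1$ is a Lie subalgebra of $\mathfrak n$. 2) If $J_Z(\mathfrak v_1)\subset\mathfrak v_2$ for any $Z\in\mathfrak z_2$ and $J_Z(\mathfrak v_1)\subset\mathfrak v_1$ for any $Z\in\mathfrak z_1$, then the Lie subalgebra $\mathfrak n_1$ (with the induced scalar product) generates a totally geodesic submanifold $(N_1,g_1)$ of $(N,g)$.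
   Context: A 2-step pseudo-Riemannian nilmanifold $(N,g)$ is a (connected) 2-step nilpotent Lie group $N$ with a left-invariant pseudo-Riemannian metric $g$; let $\langle\cdot,\cdot\rangle$ be the corresponding non-degenerate symmetric bilinear form on its Lie algebra $\mathfrak n$. The centre $\mathfrak z$ of $\mathfrak n$ is assumed non-degenerate for $\langle\cdot,\cdot\rangle$, and $\mathfrak v=\mathfrak z^\perp$. A subspace is non-degenerate if the restriction of $\langle\cdot,\cdot\rangle$ to it is non-degenerate. For $Z\in\mathfrak z$ the operator $J_Z\colon\mathfrak v\to\mathfrak v$ is defined by $\langle J_Z(X),Y\rangle=\langle[X,Y],Z\rangle$ for $X,Y\in\mathfrak v$. $N_1$ is the connected Lie subgroup of $N$ with Lie algebra $\mathfrak n_1$ and $g_1$ is the induced left-invariant metric. *)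

(* Defs.v *)
From HB Require Import structures.
From mathcomp Require Import all_boot all_order all_algebra.
From mathcomp Require Import all_classical all_reals all_analysis.

Set Implicit Arguments.
Unset Strict Implicit.
Unset Printing Implicit Defensive.

Import Order.TTheory GRing.Theory Num.Theory.
Import numFieldNormedType.Exports.
Local Open Scope classical_set_scope.
Local Open Scope ring_scope.

(* [V] and [W] are meant to be finite dimensional and [U] open; functions are
   total, and their values outside [U] are irrelevant. *)
Fixpoint Ck (R : realType) (V W : normedModType R) (k : nat)
    (U : set V) (f : V -> W) : Prop :=
  if k is k'.+1 then
    (forall x, U x -> differentiable f x) /\ (forall v, Ck k' U ('D_v f))
  else forall x, U x -> {for x, continuous f}.

Definition smooth (R : realType) (V W : normedModType R)
    (U : set V) (f : V -> W) : Prop := forall k, Ck k U f.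

Record chart (R : realType) (m : nat) (T : topologicalType) := Chart {
  cdom : set T;
  cto : T -> 'rV[R]_m;
  cfrom : 'rV[R]_m -> T;
  cdom_open : open cdom;
  cto_open : open (cto @` cdom);
  ctoK : forall x, cdom x -> cfrom (cto x) = x;
  cto_continuous : forall x, cdom x -> {for x, continuous cto};
  cfrom_continuous :
    forall u, (cto @` cdom) u -> {for u, continuous cfrom} }.

(* The atlas is indexed by the points, [chart_at p] being a chart around [p].
   The tangent space at [p] is then 'rV[R]_m, a tangent vector at [p] being
   represented by its components in the chart [chart_at p]. *)
Record manifold (R : realType) (m : nat) := Manifold {
  mcarrier :> topologicalType;
  chart_at : mcarrier -> chart R m mcarrier;
  mem_chart_at : forall p, cdom (chart_at p) p;
  chart_compat : forall p q,
    smooth (cto (chart_at p) @` (cdom (chart_at p) `&` cdom (chart_at q)))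
           (cto (chart_at q) \o cfrom (chart_at p));
  mhausdorff : hausdorff_space mcarrier;
  msecond_countable : @second_countable mcarrier }.

Section Manifolds.
Context {R : realType}.

Definition smooth_fun m (M : manifold R m) (W : set M) (f : M -> R) : Prop :=
  forall p : M, smooth (cto (chart_at p) @` (cdom (chart_at p) `&` W))
                       (f \o cfrom (chart_at p) : 'rV[R]_m -> R^o).

Definition smooth_map m m' (M : manifold R m) (M' : manifold R m')
    (F : M -> M') : Prop :=
  continuous F /\
  forall (p : M) (q : M'),
    smooth (cto (chart_at p) @`
              (cdom (chart_at p) `&` F @^-1` cdom (chart_at q)))
           (cto (chart_at q) \o F \o cfrom (chart_at p)).

(* Smoothness of a map M x M -> M, in the product charts of M x M. *)
Definition smooth_map2 m (M : manifold R m) (F : M -> M -> M) : Prop :=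
  continuous (fun u : M * M => F u.1 u.2) /\
  forall p q r : M,
    smooth ((fun u : M * M => (cto (chart_at p) u.1, cto (chart_at q) u.2)) @`
              [set u | [/\ cdom (chart_at p) u.1, cdom (chart_at q) u.2
                         & cdom (chart_at r) (F u.1 u.2)]])
           (fun w : 'rV[R]_m * 'rV[R]_m =>
              cto (chart_at r)
                (F (cfrom (chart_at p) w.1) (cfrom (chart_at q) w.2))).

Definition tangent_map m m' (M : manifold R m) (M' : manifold R m')
    (F : M -> M') (p : M) (v : 'rV[R]_m) : 'rV[R]_m' :=
  'D_v (cto (chart_at (F p)) \o F \o cfrom (chart_at p)) (cto (chart_at p) p).

Definition vfield m (M : manifold R m) := M -> 'rV[R]_m.

Definition vact m (M : manifold R m) (X : vfield M) (f : M -> R) (p : M) : R :=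
  'D_(X p) (f \o cfrom (chart_at p) : 'rV[R]_m -> R^o) (cto (chart_at p) p).

Definition smooth_vfield m (M : manifold R m) (X : vfield M) : Prop :=
  forall (W : set M) (f : M -> R),
    open W -> smooth_fun W f -> smooth_fun W (vact X f).

Definition is_lie_bracket m (M : manifold R m) (X Y Z : vfield M) : Prop :=
  forall (W : set M) (f : M -> R), open W -> smooth_fun W f ->
  forall p, W p -> vact Z f p = vact X (vact Y f) p - vact Y (vact X f) p.

(* Field of bilinear forms on the tangent spaces. *)
Definition bform_field m (M : manifold R m) :=
  M -> 'rV[R]_m -> 'rV[R]_m -> R.

Record is_pseudo_riemannian m (M : manifold R m) (g : bform_field M) : Prop := {
  pr_linear : forall p a u v w,
    g p (a *: u + v) w = a * g p u w + g p v w;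
  pr_sym : forall p u v, g p u v = g p v u;
  pr_nondeg : forall p u, (forall v, g p u v = 0) -> u = 0;
  pr_smooth : forall X Y : vfield M, smooth_vfield X -> smooth_vfield Y ->
    smooth_fun [set: M] (fun p => g p (X p) (Y p)) }.

(* Only the values of [nabla] on smooth vector fields are meaningful. *)
Record is_levi_civita m (M : manifold R m) (g : bform_field M)
    (nabla : vfield M -> vfield M -> vfield M) : Prop := {
  lc_smooth : forall X Y, smooth_vfield X -> smooth_vfield Y ->
    smooth_vfield (nabla X Y);
  lc_tensorial : forall (f : M -> R) X X' Y,
    smooth_fun [set: M] f -> smooth_vfield X -> smooth_vfield X' ->
    smooth_vfield Y ->
    nabla (fun p => f p *: X p + X' p) Y =
      (fun p => f p *: nabla X Y p + nabla X' Y p);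
  lc_leibniz : forall (f : M -> R) X Y Y',
    smooth_fun [set: M] f -> smooth_vfield X -> smooth_vfield Y ->
    smooth_vfield Y' ->
    nabla X (fun p => f p *: Y p + Y' p) =
      (fun p => f p *: nabla X Y p + vact X f p *: Y p + nabla X Y' p);
  lc_torsion_free : forall X Y, smooth_vfield X -> smooth_vfield Y ->
    is_lie_bracket X Y (fun p => nabla X Y p - nabla Y X p);
  lc_metric : forall X Y Z,
    smooth_vfield X -> smooth_vfield Y -> smooth_vfield Z -> forall p,
    vact X (fun q => g q (Y q) (Z q)) p =
      g p (nabla X Y p) (Z p) + g p (Y p) (nabla X Z p) }.

Definition immersion m m' (M : manifold R m) (M' : manifold R m')
    (F : M -> M') : Prop :=
  smooth_map F /\ forall p, injective (tangent_map F p).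

Definition pullback_form m m' (M : manifold R m) (M' : manifold R m')
    (F : M -> M') (g : bform_field M') : bform_field M :=
  fun p u v => g (F p) (tangent_map F p u) (tangent_map F p v).

Definition tangent_along m m' (M : manifold R m) (M' : manifold R m')
    (F : M -> M') (V : set M) (X : vfield M') : Prop :=
  forall q, V q -> exists u, X (F q) = tangent_map F q u.

(* An immersed submanifold F : M -> M' is totally geodesic when the induced
   form F^*g is non-degenerate and the second fundamental form, i.e. the normal
   component of nabla_X Y for X, Y tangent to M, vanishes. As M need not be
   embedded, tangency to M is only required along the sheet F(V), V being an
   arbitrary open subset of M. *)
Definition totally_geodesic m m' (M : manifold R m) (M' : manifold R m')
    (F : M -> M') (g : bform_field M') : Prop :=
  [/\ immersion F,
      forall q u, (forall v, pullback_form F g q u v = 0) -> u = 0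
    & forall nabla, is_levi_civita g nabla ->
      forall (V : set M) (X Y : vfield M'), open V ->
        smooth_vfield X -> smooth_vfield Y ->
        tangent_along F V X -> tangent_along F V Y ->
        tangent_along F V (nabla X Y)].

Record lie_group m := LieGroup {
  lg_manifold :> manifold R m;
  lmul : lg_manifold -> lg_manifold -> lg_manifold;
  linv : lg_manifold -> lg_manifold;
  lone : lg_manifold;
  lmulA : forall a b c, lmul a (lmul b c) = lmul (lmul a b) c;
  lmul1g : forall a, lmul lone a = a;
  lmulVg : forall a, lmul (linv a) a = lone;
  lmul_smooth : smooth_map2 lmul;
  linv_smooth : smooth_map linv }.

Definition left_invariant m (N : lie_group m) (X : vfield N) : Prop :=
  smooth_vfield X /\
  forall a p : N, tangent_map (lmul a) p (X p) = X (lmul a p).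

(* [fld] identifies the bracketed vector space [n] with the Lie algebra of
   left-invariant vector fields on [N]. *)
Record is_lie_algebra_of m (N : lie_group m) (n : vectType R)
    (br : n -> n -> n) (fld : n -> vfield N) : Prop := {
  la_linear : forall a x y p, fld (a *: x + y) p = a *: fld x p + fld y p;
  la_injective : injective fld;
  la_left_invariant : forall X, left_invariant X <-> exists x, fld x = X;
  la_bracket : forall x y, is_lie_bracket (fld x) (fld y) (fld (br x y)) }.

Definition two_step_nilpotent (n : vectType R) (br : n -> n -> n) : Prop :=
  (exists x y, br x y != 0) /\ (forall x y w, br (br x y) w = 0).

Definition left_invariant_form m (N : lie_group m) (g : bform_field N) : Prop :=
  forall (a p : N) u v,
    g (lmul a p) (tangent_map (lmul a) p u) (tangent_map (lmul a) p v) =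
    g p u v.

Definition scalar_product m (N : lie_group m) (g : bform_field N)
    (n : vectType R) (fld : n -> vfield N) (x y : n) : R :=
  g (lone N) (fld x (lone N)) (fld y (lone N)).

(* [iota] : H -> N exhibits the connected Lie group [H] as the connected Lie
   subgroup of [N] whose Lie algebra is [n1]: an element of the Lie algebra of
   N lies in [n1] iff the corresponding field is iota-related to a
   left-invariant field of H. *)
Record is_lie_subgroup_of_algebra m (N : lie_group m) (n : vectType R)
    (fld : n -> vfield N) (n1 : {vspace n}) m1 (H : lie_group m1)
    (iota : H -> N) : Prop := {
  ls_connected : connected [set: H];
  ls_morph : forall a b, iota (lmul a b) = lmul (iota a) (iota b);
  ls_injective : injective iota;
  ls_immersion : immersion iota;
  ls_algebra : forall x, x \in n1 <->
    exists2 Y : vfield H, left_invariant Y &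
      forall q, tangent_map iota q (Y q) = fld x (iota q) }.

Section LinearAlgebra.
Variables (n : vectType R) (br : n -> n -> n) (sp : n -> n -> R).
Implicit Types U V W z v : {vspace n}.

Definition is_centre z : Prop := forall x, x \in z <-> forall y, br x y = 0.

Definition is_nondegenerate U : Prop :=
  forall x, x \in U -> (forall y, y \in U -> sp x y = 0) -> x = 0.

(* [W] is the orthogonal complement of [U] inside [V]. *)
Definition is_orth_in V U W : Prop :=
  forall x, x \in W <-> x \in V /\ forall y, y \in U -> sp x y = 0.

(* The values of [J] outside z x v are irrelevant. *)
Definition is_J z v (J : n -> n -> n) : Prop :=
  forall c x, c \in z -> x \in v ->
    J c x \in v /\ forall y, y \in v -> sp (J c x) y = sp (br x y) c.

Definition is_lie_subalgebra U : Prop :=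
  forall x y, x \in U -> y \in U -> br x y \in U.

End LinearAlgebra.

End Manifolds.

Arguments lie_group R m : clear implicits.

(* Main.v *)
Require Import Defs.
From HB Require Import structures.
From mathcomp Require Import all_boot all_order all_algebra.
From mathcomp Require Import lra.
From mathcomp Require Import all_classical all_reals all_analysis.

(** The first assertion is linear algebra.  For x, y in v1 the bracket [x, y]
   lies in z, and <[x, y], c> = <J_c x, y> = 0 for c in z2, so [x, y] lies in
   z1; brackets with elements of z vanish.

   For the second assertion, let W be the left-invariant field of a vector w
   orthogonal to n1 = z1 + v1, and let X, Y be fields tangent to N1 along an
   open piece of it.  There <Y, W> vanishes, so differentiating it along X gives
   <nabla_X Y, W> = - <Y, nabla_X W>.  The right-hand side depends only on the
   values of X and Y at the point ([nabla_pointwise]), which are those of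
   left-invariant fields with x, y in n1 ([subgroup_tangent]).  For
   left-invariant fields Koszul's formula ([koszul]) only involves
   <[x, w], y>, <[w, y], x> and <[y, x], w>.  The last product is zero because
   n1 is a subalgebra.  The other two are zero because, by the hypothesis on
   J_c for c in z1, <[x, w], y> = <J_c x', w'> = 0 where c is the z-component
   of y, x' that of x in v1 and w' that of w in v ([bracket_orth_sum]).  So
   nabla_X Y is orthogonal to every such W, hence tangent to N1, as n1 is
   non-degenerate.

   Two facts of Lie theory have to be built from the charts.  Brackets are
   bilinear and antisymmetric because a vector field is determined by its action
   on functions ([lie_bracket_unique]).  Every tangent vector is the value of a
   left-invariant field ([left_invariant_at]): the field a |-> d(L_a) u is
   smooth, since f (a b) is a smooth function of the coordinates of a and b
   and its derivative in b at b = 1 is again smooth in a. *)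

Set Implicit Arguments.
Unset Strict Implicit.
Unset Printing Implicit Defensive.

Import Order.TTheory GRing.Theory Num.Theory.
Import numFieldNormedType.Exports.
Local Open Scope classical_set_scope.
Local Open Scope ring_scope.

(** * Smooth functions between normed spaces *)

Lemma differentiable_near_eq (R : realType) (V W : normedModType R)
    (f g : V -> W) (x : V) :
  (\near x, f x = g x) -> differentiable f x -> differentiable g x.
Proof.
move=> fg df; have fgx : f x = g x by exact: nbhs_singleton fg.
(* the two functions have the same first-order expansion at x *)
have dg : g \o shift x = cst (g x) + 'd f x +o_ 0 id.
  apply/eqaddoP => _/posnumP[e].
  have /eqaddoP /(_ e%:num) := diff_locally df.
  move=> /(_ [gt0 of e%:num]); rewrite !near_simpl.
  have : \forall h \near (0 : V), f (h + x) = g (h + x).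
    by move: fg; rewrite (near_shift 0 x)/= subr0.
  apply: filterS2 => h /= fgh.
  rewrite -![(_ + _ : _ -> _) _]/(_ + _) -![(- _ : _ -> _) _]/(- _)/= /cst.
  by rewrite fgh fgx.
have dfc : continuous ('d f x) by exact: diff_continuous.
apply/diff_locallyP; have -> := diff_unique dfc dg; by split.
Qed.

Section CkTheory.
Context {R : realType}.
Implicit Types V W : normedModType R.

Lemma Ck_continuous V W k (U : set V) (f : V -> W) :
  Ck k U f -> forall x, U x -> {for x, continuous f}.
Proof.
by case: k => //= k [df _] x Ux; apply: differentiable_continuous; exact: df.
Qed.

Lemma CkS V W k (U : set V) (f : V -> W) : Ck k.+1 U f -> Ck k U f.
Proof.
elim: k f => [|k IH] f; first by apply: Ck_continuous.
by move=> [df Df]; split => // v; apply/IH/Df.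
Qed.

Lemma Ck_subset V W k (U U' : set V) (f : V -> W) :
  U `<=` U' -> Ck k U' f -> Ck k U f.
Proof.
move=> UU'; elim: k f => [|k IH] f /=; first by move=> cf x /UU' /cf.
by move=> [df Df]; split => [x /UU' /df//|v]; apply/IH/Df.
Qed.

Lemma Ck_eq V W k (U : set V) (f g : V -> W) : open U ->
  (forall x, U x -> f x = g x) -> Ck k U f -> Ck k U g.
Proof.
move=> oU; elim: k f g => [|k IH] f g fg /=.
  move=> cf x Ux; have Nx : nbhs x U by exact: open_nbhs_nbhs.
  have cfx : f @ x --> g x by rewrite -(fg x Ux); exact: cf.
  by apply: cvg_trans cfx; apply: near_eq_cvg; apply: filterS Nx => y /fg.
have N x : U x -> \forall y \near x, f y = g y.
  by move=> Ux; apply: filterS (open_nbhs_nbhs (conj oU Ux)) => y /fg.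
move=> [df Df]; split=> [x Ux|v].
  by apply: differentiable_near_eq (df x Ux); exact: N.
by apply: IH (Df v) => x Ux; apply: near_eq_derive; exact: N.
Qed.

(** Smoothness is a pointwise condition, so it can be checked locally. *)
Lemma Ck_local V W k (U : set V) (f : V -> W) :
  (forall x, U x -> exists2 U', U' x & Ck k U' f) -> Ck k U f.
Proof.
elim: k f => [|k IH] f /= cf; first by move=> x /cf[U' U'x]; apply.
split=> [x /cf[U' U'x [+ _]]|v]; first exact.
by apply: IH => x /cf[U' U'x [_ +]]; exists U'.
Qed.

Lemma smooth_eq V W (U : set V) (f g : V -> W) : open U ->
  (forall x, U x -> f x = g x) -> smooth U f -> smooth U g.
Proof. by move=> oU fg sf k; exact: Ck_eq (sf k). Qed.

Lemma smooth_subset V W (U U' : set V) (f : V -> W) :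
  U `<=` U' -> smooth U' f -> smooth U f.
Proof. by move=> UU' sf k; exact: Ck_subset (sf k). Qed.

Lemma smooth_local V W (U : set V) (f : V -> W) :
  (forall x, U x -> exists2 U', U' x & smooth U' f) -> smooth U f.
Proof. by move=> lf k; apply: Ck_local => x /lf[U' U'x sf]; exists U'. Qed.

Lemma smooth_differentiable V W (U : set V) (f : V -> W) (x : V) :
  smooth U f -> U x -> differentiable f x.
Proof. by move=> /(_ 1)[df _] /df. Qed.

Lemma smooth_derive V W (U : set V) (f : V -> W) v :
  smooth U f -> smooth U ('D_v f).
Proof. by move=> sf k; have [_ Df] := sf k.+1; exact: Df. Qed.

Lemma Ck_cst V W k (U : set V) (c : W) : Ck k U (cst c).
Proof.
elim: k c => [|k IH] c /=; first by move=> x _; exact: (@cst_continuous V W c x).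
split=> [x _|v]; first exact: differentiable_cst.
suff -> : 'D_v (cst c : V -> W) = cst 0 by [].
by apply/funext => x; rewrite derive_cst.
Qed.

Lemma CkD V W k (U : set V) (f g : V -> W) : open U ->
  Ck k U f -> Ck k U g -> Ck k U (f \+ g).
Proof.
move=> oU; elim: k f g => [|k IH] f g /=.
  by move=> cf cg x Ux; apply: cvgD; [exact: cf|exact: cg].
move=> [df Df] [dg Dg]; split => [x Ux|v].
  by apply: differentiableD; [exact: df|exact: dg].
apply: Ck_eq (IH _ _ (Df v) (Dg v)) => //= x Ux.
by rewrite -deriveD//; apply: diff_derivable; [exact: df|exact: dg].
Qed.

Lemma CkM V k (U : set V) (f g : V -> R^o) : open U ->
  Ck k U f -> Ck k U g -> Ck k U (fun x => f x * g x : R^o).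
Proof.
move=> oU; elim: k f g => [|k IH] f g.
  by move=> cf cg x Ux; apply: cvgM; [exact: cf|exact: cg].
move=> Cf Cg; have [df Df] := Cf; have [dg Dg] := Cg; split => [x Ux|v].
  by apply: differentiableM; [exact: df|exact: dg].
have Cfg := CkD oU (IH _ _ (CkS Cf) (Dg v)) (IH _ _ (CkS Cg) (Df v)).
apply: Ck_eq Cfg => //= x Ux.
rewrite -[RHS]/(derive (f * g) x v) deriveM//; apply: diff_derivable.
  exact: df.
exact: dg.
Qed.

Lemma Ck_sum V k (U : set V) (I : Type) (r : seq I) (f : I -> V -> R^o) :
  open U -> (forall i, Ck k U (f i)) -> Ck k U (fun x => \sum_(i <- r) f i x : R^o).
Proof.
move=> oU Cf; elim: r => [|i r IH].
  by apply: Ck_eq (Ck_cst k U (0 : R^o)) => // x Ux; rewrite big_nil.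
by apply: Ck_eq (CkD oU (Cf i) IH) => // x Ux; rewrite big_cons.
Qed.

Lemma Ck_coord V k (U : set V) m (f : V -> 'rV[R]_m) i : open U ->
  Ck k U f -> Ck k U (fun x => f x 0 i : R^o).
Proof.
move=> oU; elim: k f => [|k IH] f /=.
  move=> cf x Ux; apply: (@continuous_comp _ _ _ f (fun u : 'rV[R]_m => u 0 i : R^o)).
    exact: cf.
  exact: coord_continuous.
move=> [df Df]; split => [x Ux|v].
  apply: (@differentiable_comp _ _ _ _ f (fun u : 'rV[R]_m => u 0 i : R^o)).
    exact: df.
  exact: differentiable_coord.
apply: Ck_eq (IH _ (Df v)) => //= x Ux.
by rewrite derive_mx ?mxE//; apply: diff_derivable; exact: df.
Qed.

(** The chain rule with directional derivatives only: the differential of [f]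
   at [h x] is expanded on the canonical basis, which keeps the formula inside
   the class of functions stable under the induction on the order. *)
Lemma derive_comp_rV V m (h : V -> 'rV[R]_m) (f : 'rV[R]_m -> R^o) x v :
  differentiable h x -> differentiable f (h x) ->
  'D_v (f \o h) x =
    \sum_(i < m) ('D_v h x) 0 i * 'D_(delta_mx 0 i) f (h x).
Proof.
move=> dh df; rewrite deriveE; last exact: differentiable_comp.
rewrite diff_comp/=// -(deriveE _ dh) [in LHS](row_sum_delta ('D_v h x)).
rewrite linear_sum; apply: eq_bigr => i _.
by rewrite linearZ/= (deriveE _ df).
Qed.

(** Only a real-valued [f] on row vectors is needed: its arguments are then
   coordinates, and the class is closed under the sums of products that
   [derive_comp_rV] produces. *)
Lemma Ck_comp V m k (U : set V) (U' : set 'rV[R]_m)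
    (h : V -> 'rV[R]_m) (f : 'rV[R]_m -> R^o) : open U ->
  (forall x, U x -> U' (h x)) ->
  Ck k U h -> Ck k U' f -> Ck k U (f \o h).
Proof.
move=> oU hU; elim: k f => [|k IH] f.
  move=> ch cf x Ux; apply: continuous_comp; first exact: ch.
  by apply: cf; exact: hU.
move=> Ch [df Df]; have [dh Dh] := Ch; split => [x Ux|v].
  by apply: differentiable_comp; [exact: dh|apply/df/hU].
pose G x : R^o :=
  \sum_(i < m) ('D_v h x) 0 i * ('D_(delta_mx 0 i) f \o h) x.
apply: (@Ck_eq _ _ _ _ G) => // [x Ux|].
  by rewrite derive_comp_rV//; [exact: dh|apply/df/hU].
apply: Ck_sum => // i; apply: CkM => //.
  exact: Ck_coord (Dh v).
by apply: IH; [exact: CkS Ch|exact: Df].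
Qed.

(** Composition with a map having constant derivatives needs no product rule,
   so the target can be any normed space; it is used for slices x |-> (x, e). *)
Lemma Ck_affine V V' W k (U : set V) (h : V -> V') (l : V -> V')
    (f : V' -> W) : open U ->
  (forall x v, is_derive x v h (l v)) -> (forall x, differentiable h x) ->
  forall U' : set V', (forall x, U x -> U' (h x)) ->
  Ck k U' f -> Ck k U (f \o h).
Proof.
move=> oU Dh dh U' hU; elim: k f => [|k IH] f.
  move=> cf x Ux; apply: continuous_comp; last by apply/cf/hU.
  exact: differentiable_continuous.
move=> [df Df]; split => [x Ux|v].
  by apply: differentiable_comp => //; apply/df/hU.
apply: Ck_eq (IH _ (Df (l v))) => // x Ux.
have dfx := df _ (hU _ Ux).
rewrite (@deriveE _ _ _ (f \o h)); last exact: differentiable_comp.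
rewrite diff_comp//= -(deriveE v (dh x)) (@deriveE _ _ _ f)//.
by have [_ ->] := Dh x v.
Qed.

End CkTheory.

(** * Tangent maps and vector fields in charts *)

Section ManifoldCalculus.
Context {R : realType}.

Lemma cfrom_near m (T : topologicalType) (c : chart R m T) (p : T) (A : set T) :
  cdom c p -> nbhs p A -> \forall u \near cto c p, A (cfrom c u).
Proof.
move=> cp Ap; have cc : {for cto c p, continuous (cfrom c)}.
  by apply: cfrom_continuous; exists p.
by apply: cc; rewrite /= ctoK.
Qed.

Lemma ctoK_near m (T : topologicalType) (c : chart R m T) (p : T) :
  cdom c p ->
  \forall u \near cto c p, cdom c (cfrom c u) /\ cto c (cfrom c u) = u.
Proof.
move=> cp; have : nbhs (cto c p) (cto c @` cdom c).
  by apply: open_nbhs_nbhs; split; [exact: cto_open|exists p].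
by apply: filterS => u [q cq <-]; rewrite ctoK.
Qed.

Lemma open_chart_image m (T : topologicalType) (c : chart R m T) (W : set T) :
  open W -> open (cto c @` (cdom c `&` W)).
Proof.
move=> oW; rewrite openE => _ [p [cp Wp] <-].
have := cfrom_near cp (open_nbhs_nbhs (conj oW Wp)).
apply: filterS2 (ctoK_near cp) => u [cu uK] Wu.
by exists (cfrom c u).
Qed.

Lemma open_chart_image2 m m' (T T' : topologicalType) (c : chart R m T)
    (c' : chart R m' T') (W : set (T * T')) : open W ->
  open ((fun u : T * T' => (cto c u.1, cto c' u.2)) @`
          [set u | [/\ cdom c u.1, cdom c' u.2 & W u]]).
Proof.
move=> oW; rewrite openE => _ [[p p'] [/= cp cp' Wp] <-].
have [[/= A A'] [Ap Ap'] AW] : nbhs (p, p') W by exact: open_nbhs_nbhs.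
pose B := [set u | [/\ cdom c (cfrom c u), cto c (cfrom c u) = u
                      & A (cfrom c u)]].
pose B' := [set u | [/\ cdom c' (cfrom c' u), cto c' (cfrom c' u) = u
                       & A' (cfrom c' u)]].
have nB : nbhs (cto c p) B.
  have := cfrom_near cp Ap.
  by apply: filterS2 (ctoK_near cp) => u [cu uK] Au; split.
have nB' : nbhs (cto c' p') B'.
  have := cfrom_near cp' Ap'.
  by apply: filterS2 (ctoK_near cp') => u [cu uK] Au; split.
exists (B, B') => //= -[u u'] [/= [cu uK Au] [cu' uK' Au']].
exists (cfrom c u, cfrom c' u') => /=; last by rewrite uK uK'.
by split=> //; exact: AW.
Qed.

(** Continuity is a separate condition: the chart around [F p] says nothing of
   [F] outside its domain, and continuity keeps [F] inside it near [p]. *)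
Definition mdifferentiable m m' (M : manifold R m) (M' : manifold R m')
    (F : M -> M') (p : M) : Prop :=
  {for p, continuous F} /\
  differentiable (cto (chart_at (F p)) \o F \o cfrom (chart_at p))
                 (cto (chart_at p) p).

Section ChainRule.
Variables (m m' : nat) (M : manifold R m) (M' : manifold R m').
Variables (F : M -> M') (p : M).
Hypothesis dF : mdifferentiable F p.

Lemma comp_map_near (V : normedModType R) (h : M' -> V) :
  \forall u \near cto (chart_at p) p,
    ((h \o cfrom (chart_at (F p))) \o
      (cto (chart_at (F p)) \o F \o cfrom (chart_at p))) u =
    (h \o F \o cfrom (chart_at p)) u.
Proof.
have [cF _] := dF; have cp := mem_chart_at p; have cFp := mem_chart_at (F p).
have : nbhs p (F @^-1` cdom (chart_at (F p))).
  by apply: cF; apply: open_nbhs_nbhs; split=> //; exact: cdom_open.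
by move=> /(cfrom_near cp); apply: filterS => u Fu /=; rewrite ctoK.
Qed.

(** The chain rule for [h \o F]; with [h] a function it describes derivatives
   along [F], and with [h] a map read in a chart it is the functoriality of
   tangent maps. *)
Lemma derive_comp_map (V : normedModType R) (h : M' -> V) v :
  differentiable (h \o cfrom (chart_at (F p))) (cto (chart_at (F p)) (F p)) ->
  'D_v (h \o F \o cfrom (chart_at p)) (cto (chart_at p) p) =
  'D_(tangent_map F p v) (h \o cfrom (chart_at (F p)))
    (cto (chart_at (F p)) (F p)).
Proof.
move=> dh; have [_ dFp] := dF.
have hp : (cto (chart_at (F p)) \o F \o cfrom (chart_at p)) (cto (chart_at p) p)
    = cto (chart_at (F p)) (F p) by rewrite /= ctoK//; exact: mem_chart_at.
rewrite -(near_eq_derive _ (comp_map_near h)) deriveE; last first.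
  by apply: differentiable_comp; rewrite ?hp.
by rewrite diff_comp ?hp//= /tangent_map (deriveE _ dFp) (deriveE _ dh).
Qed.

End ChainRule.

Lemma tangent_map0 m m' (M : manifold R m) (M' : manifold R m') (F : M -> M') p :
  tangent_map F p 0 = 0.
Proof. by rewrite /tangent_map derive0. Qed.

Lemma tangent_map_id m (M : manifold R m) (F : M -> M) (p : M) v :
  F =1 id -> tangent_map F p v = v.
Proof.
move=> /funext ->; rewrite /tangent_map -[RHS](derive_id (cto (chart_at p) p)).
apply: near_eq_derive; apply: filterS (ctoK_near (mem_chart_at p)) => u [].
by [].
Qed.

Lemma tangent_map_comp m1 m2 m3 (M1 : manifold R m1) (M2 : manifold R m2)
    (M3 : manifold R m3) (F : M1 -> M2) (G : M2 -> M3) p v :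
  mdifferentiable F p -> mdifferentiable G (F p) ->
  tangent_map (G \o F) p v = tangent_map G (F p) (tangent_map F p v).
Proof. by move=> dF [cG dG]; exact: (derive_comp_map dF v dG). Qed.

Lemma smooth_map_mdifferentiable m m' (M : manifold R m) (M' : manifold R m')
    (F : M -> M') p : smooth_map F -> mdifferentiable F p.
Proof.
move=> [cF sF]; split; first exact: cF.
apply: smooth_differentiable (sF p (F p)) _; exists p => //.
by split; exact: mem_chart_at.
Qed.

Section Functions.
Variables (m : nat) (M : manifold R m).
Implicit Types (W : set M) (f h : M -> R) (X Y Z : vfield M) (p : M).

Lemma smooth_fun_differentiable W f p : smooth_fun W f -> W p ->
  differentiable (f \o cfrom (chart_at p) : 'rV[R]_m -> R^o)
                 (cto (chart_at p) p).
Proof.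
move=> sf Wp; apply: smooth_differentiable (sf p) _; exists p => //.
by split=> //; exact: mem_chart_at.
Qed.

Lemma smooth_fun_eq W f h : open W -> {in W, f =1 h} ->
  smooth_fun W f -> smooth_fun W h.
Proof.
move=> oW fh sf p; apply: smooth_eq (sf p); first exact: open_chart_image.
by move=> _ [q [cq Wq] <-] /=; rewrite ctoK// fh// inE.
Qed.

Lemma smooth_fun_subset W W' f : W `<=` W' -> smooth_fun W' f -> smooth_fun W f.
Proof.
move=> WW' sf p; apply: smooth_subset (sf p) => _ [q [cq Wq] <-].
by exists q => //; split=> //; exact: WW'.
Qed.

Lemma smooth_fun_cst W (c : R) : smooth_fun W (fun=> c).
Proof. by move=> p k; exact: (@Ck_cst _ _ R^o). Qed.

Lemma smooth_funD W f h : open W -> smooth_fun W f -> smooth_fun W h ->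
  smooth_fun W (fun q => f q + h q).
Proof.
by move=> oW sf sh p k; apply: CkD (sf p k) (sh p k); exact: open_chart_image.
Qed.

Lemma smooth_funM W f h : open W -> smooth_fun W f -> smooth_fun W h ->
  smooth_fun W (fun q => f q * h q).
Proof.
by move=> oW sf sh p k; apply: CkM (sf p k) (sh p k); exact: open_chart_image.
Qed.

Lemma vact_eq W f h X p : open W -> W p -> {in W, f =1 h} ->
  vact X f p = vact X h p.
Proof.
move=> oW Wp fh; apply: near_eq_derive.
have Np : nbhs p W by exact: open_nbhs_nbhs.
apply: filterS (cfrom_near (mem_chart_at p) Np) => u Wu /=.
by rewrite fh//; exact: mem_set.
Qed.

Lemma vact_cst X (c : R) p : vact X (fun=> c) p = 0.
Proof. exact: (@derive_cst _ _ R^o). Qed.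

Lemma vactD_fun W f h X p : W p -> smooth_fun W f -> smooth_fun W h ->
  vact X (fun q => f q + h q) p = vact X f p + vact X h p.
Proof.
move=> Wp sf sh; rewrite /vact -deriveD//; apply: diff_derivable.
  exact: smooth_fun_differentiable sf Wp.
exact: smooth_fun_differentiable sh Wp.
Qed.

Lemma vactZ_fun W f X p (a : R) : W p -> smooth_fun W f ->
  vact X (fun q => a * f q) p = a * vact X f p.
Proof.
move=> Wp sf; rewrite /vact -[RHS]/(a *: (_ : R^o)) -deriveZ//.
by apply: diff_derivable; exact: smooth_fun_differentiable sf Wp.
Qed.

Lemma vact_linear W f X Y Z p (a : R) : W p -> smooth_fun W f ->
  Z p = a *: X p + Y p -> vact Z f p = a * vact X f p + vact Y f p.
Proof.
move=> Wp sf Zp; have df := smooth_fun_differentiable sf Wp.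
by rewrite /vact Zp !(deriveE _ df) linearP.
Qed.

Definition chart_coord p i : M -> R := fun q => cto (chart_at p) q 0 i.

Lemma smooth_chart_coord p i : smooth_fun (cdom (chart_at p)) (chart_coord p i).
Proof.
move=> q k; apply: (Ck_coord i) (chart_compat q p k).
by apply: open_chart_image; exact: cdom_open.
Qed.

Lemma vact_chart_coord X p i : vact X (chart_coord p i) p = X p 0 i.
Proof.
have D : derivable id (cto (chart_at p) p) (X p) by exact: derivable_id.
have -> : X p 0 i = ('D_(X p) id (cto (chart_at p) p)) 0 i by rewrite derive_id.
rewrite (derive_mx D) mxE; apply: near_eq_derive.
apply: filterS (ctoK_near (mem_chart_at p)) => u [_ uK].
by rewrite /chart_coord /= uK.
Qed.

(** Vector fields are separated by functions: the chart coordinates recover the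
   components. *)
Lemma vact_inj X Y p :
  (forall W f, open W -> smooth_fun W f -> W p -> vact X f p = vact Y f p) ->
  X p = Y p.
Proof.
move=> XY; apply/rowP => i; rewrite -(vact_chart_coord X) -(vact_chart_coord Y).
apply: (XY (cdom (chart_at p))); first exact: cdom_open.
  exact: smooth_chart_coord.
exact: mem_chart_at.
Qed.

Lemma lie_bracket_unique X Y Z Z' :
  is_lie_bracket X Y Z -> is_lie_bracket X Y Z' -> Z = Z'.
Proof.
move=> XYZ XYZ'; apply/funext => p; apply: vact_inj => W f oW sf Wp.
by rewrite (XYZ W)// (XYZ' W).
Qed.

Lemma lie_bracketC X Y Z : is_lie_bracket X Y Z ->
  is_lie_bracket Y X (fun p => - Z p).
Proof.
move=> XYZ W f oW sf p Wp; rewrite -[RHS]opprB -(XYZ W)//.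
rewrite (@vact_linear W f Z (fun=> 0) _ p (-1))// ?scaleN1r ?addr0//.
by rewrite /vact derive0 addr0 mulN1r.
Qed.

Lemma lie_bracket_linear (a : R) X X' Y Z Z' :
  smooth_vfield X -> smooth_vfield X' -> smooth_vfield Y ->
  is_lie_bracket X Y Z -> is_lie_bracket X' Y Z' ->
  is_lie_bracket (fun p => a *: X p + X' p) Y (fun p => a *: Z p + Z' p).
Proof.
move=> sX sX' sY XYZ XYZ' W f oW sf p Wp.
have E : {in W, vact (fun p => a *: X p + X' p : 'rV[R]_m) f =1
    fun q => a * vact X f q + vact X' f q}.
  by move=> q /set_mem Wq; exact: (vact_linear Wq sf).
have sXf := sX W f oW sf; have sXf' := sX' W f oW sf.
have sYf := sY W f oW sf.
have saXf : smooth_fun W (fun q => a * vact X f q).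
  by apply: smooth_funM => //; exact: smooth_fun_cst.
rewrite (@vact_linear W f Z Z' _ p a)// (XYZ W)// (XYZ' W)//.
rewrite (@vact_linear W (vact Y f) X X' (fun q => a *: X q + X' q) p a)//.
rewrite (vact_eq Y oW Wp E).
rewrite (vactD_fun Y Wp saXf sXf').
rewrite (vactZ_fun Y a Wp sXf).
move: (vact X (vact Y f) p) (vact X' (vact Y f) p) (vact Y (vact X f) p)
  (vact Y (vact X' f) p) => A A' B B'.
by rewrite mulrBr opprD addrACA.
Qed.

Lemma smooth_vfield0 : @smooth_vfield R m M (fun=> 0).
Proof.
move=> W f oW sf; apply: smooth_fun_eq oW _ (smooth_fun_cst W 0) => p _.
by rewrite /vact derive0.
Qed.

Lemma smooth_vfieldD_scale f X Y : smooth_fun [set: M] f ->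
  smooth_vfield X -> smooth_vfield Y ->
  smooth_vfield (fun p => f p *: X p + Y p).
Proof.
move=> sf sX sY W h oW sh.
have sfX : smooth_fun W (fun q => f q * vact X h q).
  by apply: smooth_funM (sX _ _ oW sh) => //; exact: smooth_fun_subset sf.
apply: smooth_fun_eq oW _ (smooth_funD oW sfX (sY _ _ oW sh)) => p.
by move=> /set_mem Wp; apply/esym/(vact_linear Wp sh).
Qed.

End Functions.

(** By the chain rule the left-hand side is a derivative of [f \o F], a function
   that vanishes near [q] in the source; [F] may fail to be an embedding. *)
Lemma vact_comp_eq0 m m' (M : manifold R m) (M' : manifold R m')
    (F : M -> M') (V : set M) (f : M' -> R) (X : vfield M') q u :
  mdifferentiable F q -> smooth_fun [set: M'] f -> open V -> V q ->
  (forall r, V r -> f (F r) = 0) -> X (F q) = tangent_map F q u ->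
  vact X f (F q) = 0.
Proof.
move=> dF sf oV Vq f0 XF.
have df := smooth_fun_differentiable sf (I : [set: M'] (F q)).
rewrite /vact XF -(derive_comp_map dF u df).
rewrite -[RHS](@derive_cst _ _ R^o 0 (cto (chart_at q) q) u).
apply: near_eq_derive.
apply: filterS (cfrom_near (mem_chart_at q) (open_nbhs_nbhs (conj oV Vq))).
by move=> w /f0.
Qed.

End ManifoldCalculus.

(** * Left-invariant fields with a prescribed value *)

Section LieGroups.
Context {R : realType} {m : nat} (N : lie_group R m).
Implicit Types (a b p : N) (X : vfield N).

Lemma lmulgV a : lmul a (linv a) = lone N.
Proof.
by rewrite -[LHS]lmul1g -(lmulVg (linv a)) -lmulA [lmul (linv a) _]lmulA
  lmulVg lmul1g.
Qed.

Lemma lmulg1 a : lmul a (lone N) = a.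
Proof. by rewrite -(lmulVg a) lmulA lmulgV lmul1g. Qed.

Lemma mdifferentiable_lmul a p : mdifferentiable (lmul a) p.
Proof.
have [cM sM] := lmul_smooth N; split.
  apply: (@continuous_comp _ _ _ (fun q : N => (a, q))
            (fun u : N * N => lmul u.1 u.2)).
    by apply: cvg_pair; [exact: cvg_cst|exact: cvg_id].
  exact: cM.
have S := sM a p (lmul a p).
have dF := smooth_differentiable S
  (x := (cto (chart_at a) a, cto (chart_at p) p)).
have h_diff : differentiable
    (fun w : 'rV[R]_m => (cto (chart_at a) a, w)) (cto (chart_at p) p).
  exact: differentiable_pair.
have := differentiable_comp h_diff (dF _).
rewrite /comp /= ctoK; last exact: mem_chart_at.
by apply; exists (a, p) => //=; split; exact: mem_chart_at.
Qed.

Definition left_translate (u : 'rV[R]_m) : vfield N :=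
  fun a => tangent_map (lmul a) (lone N) u.

(** In the coordinates of [a] and [b], the function (a, b) |-> f (a b). *)
Let fmul (p : N) (f : N -> R) (x : 'rV[R]_m * 'rV[R]_m) : R^o :=
  f (lmul (cfrom (chart_at p) x.1) (cfrom (chart_at (lone N)) x.2)).

Let fmul_dom (p : N) (W : set N) : set ('rV[R]_m * 'rV[R]_m) :=
  (fun u : N * N => (cto (chart_at p) u.1, cto (chart_at (lone N)) u.2)) @`
    [set u | [/\ cdom (chart_at p) u.1, cdom (chart_at (lone N)) u.2
               & W (lmul u.1 u.2)]].

Let open_fmul_dom p W : open W -> open (fmul_dom p W).
Proof.
move=> oW; apply: (@open_chart_image2 R m m N N _ _ (fun u => W (lmul u.1 u.2))).
by have [/continuousP cM _] := lmul_smooth N; exact: cM.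
Qed.

Let smooth_fmul p W f : open W -> smooth_fun W f ->
  smooth (fmul_dom p W) (fmul p f).
Proof.
move=> oW sf; apply: smooth_local => _ [[a b] /= [ca cb Wab] <-].
set r := lmul a b; have [_ sM] := lmul_smooth N.
pose W' := W `&` cdom (chart_at r).
have oW' : open W' by apply: openI => //; exact: cdom_open.
exists (fmul_dom p W').
  by exists (a, b) => //; split => //; split => //; exact: mem_chart_at.
have sM' : smooth (fmul_dom p W') _ := smooth_subset _ (sM p (lone N) r).
move=> k; have := Ck_comp _ _ (sM' _ k) (sf r k).
move=> /(_ (open_fmul_dom oW')) C.
apply: Ck_eq (C _ _); first exact: open_fmul_dom.
- move=> _ [[a' b'] /= [ca' cb' [Wab' rab']] <-] /=.
  by rewrite /fmul /= !ctoK.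
- move=> _ [[a' b'] /= [ca' cb' [Wab' rab']] <-] /=.
  by exists (lmul a' b'); rewrite /= ?ctoK.
- move=> _ [[a' b'] /= [ca' cb' [Wab' rab']] <-] /=.
  by exists (a', b').
Qed.

(** The derivative of [f] along the field at [a] is the derivative of f (a b) in
   [b] at b = 1 in the direction [u].  It is obtained by deriving the smooth
   function [fmul] in the direction (0, u), then restricting it to the slice of
   points whose second component is the coordinate of 1. *)
Lemma smooth_left_translate u : smooth_vfield (left_translate u).
Proof.
move=> W f oW sf p.
have sF := smooth_fmul p oW sf.
pose e := cto (chart_at (lone N)) (lone N).
pose h (x : 'rV[R]_m) := (x, e).
have dh x : differentiable h x by exact: differentiable_pair.
have Dh x v : is_derive x v h (v, 0).
  apply: DeriveDef; first exact: diff_derivable.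
  rewrite deriveE// /h diff_pair//=.
  by congr (_, _); rewrite -deriveE// ?derive_id ?derive_cst.
have oV := open_chart_image (c := chart_at p) oW.
have hV x : (cto (chart_at p) @` (cdom (chart_at p) `&` W)) x ->
    fmul_dom p W (h x).
  move=> [a [ca Wa] <-]; exists (a, lone N) => //=; rewrite lmulg1.
  by split=> //; exact: mem_chart_at.
have sDF := smooth_derive (0, u) sF.
(* it remains to identify the derivative of [fmul] with that of [f] *)
move=> k; apply: Ck_eq (Ck_affine oV Dh dh hV (sDF k)) => //.
move=> _ [a [ca Wa] <-] /=.
have dF : differentiable (fmul p f) (h (cto (chart_at p) a)).
  by apply: smooth_differentiable sF _; apply: hV; exists a.
rewrite ctoK// /vact /left_translate.
have L : mdifferentiable (lmul a) (lone N) by exact: mdifferentiable_lmul.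
have df : differentiable (f \o cfrom (chart_at (lmul a (lone N))) : _ -> R^o)
    (cto (chart_at (lmul a (lone N))) (lmul a (lone N))).
  by rewrite lmulg1; exact: smooth_fun_differentiable sf Wa.
have := derive_comp_map L u df; rewrite lmulg1 => <-.
pose s (w : 'rV[R]_m) := (cto (chart_at p) a, w).
have ds : differentiable s e by exact: differentiable_pair.
have -> : f \o lmul a \o cfrom (chart_at (lone N)) = fmul p f \o s.
  by apply/funext => w; rewrite /fmul/= ctoK.
rewrite (@deriveE _ _ _ (fmul p f \o s)); last exact: differentiable_comp.
have sE : 'd s e u = (0, u).
  rewrite /s diff_pair//=.
  by congr (_, _); rewrite -deriveE// ?derive_id ?derive_cst.
by rewrite diff_comp//= sE (deriveE _ dF).
Qed.

Lemma left_invariant_left_translate u : left_invariant (left_translate u).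
Proof.
split; first exact: smooth_left_translate.
move=> a p; rewrite /left_translate.
have dL : mdifferentiable (lmul a) (lmul p (lone N)).
  exact: mdifferentiable_lmul.
have dp : mdifferentiable (lmul p) (lone N) by exact: mdifferentiable_lmul.
have -> : lmul (lmul a p) = lmul a \o lmul p.
  by apply/funext => q; rewrite /= lmulA.
by rewrite (tangent_map_comp _ dp dL) lmulg1.
Qed.

(** Left translations act transitively, so left-invariant fields fill every
   tangent space. *)
Lemma left_invariant_at p u : exists2 X, left_invariant X & X p = u.
Proof.
exists (left_translate (tangent_map (lmul (linv p)) p u)).
  exact: left_invariant_left_translate.
rewrite /left_translate -(lmulVg p).
have dL : mdifferentiable (lmul p) (lmul (linv p) p).
  exact: mdifferentiable_lmul.
have dV : mdifferentiable (lmul (linv p)) p by exact: mdifferentiable_lmul.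
rewrite -(tangent_map_comp _ dV dL); apply: tangent_map_id => q /=.
by rewrite lmulA lmulgV lmul1g.
Qed.

Lemma left_invariant_lmul X p : left_invariant X ->
  X p = tangent_map (lmul p) (lone N) (X (lone N)).
Proof. by move=> [_ ->]; rewrite lmulg1. Qed.

End LieGroups.

(** * Scalar products and the two-step bracket *)

Lemma functional_comb (R : realType) (n : vectType R) (f : n -> R)
    (I : Type) (r : seq I) (c : I -> R) (e : I -> n) :
  (forall a x y, f (a *: x + y) = a * f x + f y) ->
  f (\sum_(i <- r) c i *: e i) = \sum_(i <- r) c i * f (e i).
Proof.
move=> f_lin; elim: r => [|i r IH]; last by rewrite !big_cons f_lin IH.
rewrite !big_nil; have := f_lin 1 0 0.
by rewrite scaler0 addr0 mul1r -[LHS]addr0 => /addrI.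
Qed.

Section ScalarProduct.
Context {R : realType} {n : vectType R} (sp : n -> n -> R).
Hypothesis sp_lin : forall w a x y, sp (a *: x + y) w = a * sp x w + sp y w.
Hypothesis spC : forall x y, sp x y = sp y x.
Implicit Types U V W : {vspace n}.

Lemma sp_linr w a x y : sp w (a *: x + y) = a * sp w x + sp w y.
Proof. by rewrite !(spC w) sp_lin. Qed.

Lemma spDl x y w : sp (x + y) w = sp x w + sp y w.
Proof. by have := sp_lin w 1 x y; rewrite scale1r mul1r. Qed.

Lemma spDr w x y : sp w (x + y) = sp w x + sp w y.
Proof. by rewrite !(spC w) spDl. Qed.

Lemma spBl x y w : sp (x - y) w = sp x w - sp y w.
Proof. by rewrite addrC -scaleN1r sp_lin mulN1r addrC. Qed.

Lemma spNl x w : sp (- x) w = - sp x w.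
Proof.
have := spBl x x w; rewrite !subrr => sp0.
by rewrite -[- x]sub0r spBl sp0 sub0r.
Qed.

(** The Gram matrix of a basis of a non-degenerate subspace is invertible, so
   every linear functional on it is represented by one of its vectors. *)
Lemma riesz U (f : n -> R) : is_nondegenerate sp U ->
  (forall a x y, f (a *: x + y) = a * f x + f y) ->
  exists2 u, u \in U & forall y, y \in U -> sp u y = f y.
Proof.
move=> ndU f_lin; pose b := vbasis U; pose d := (\dim U).
pose e (i : 'I_d) := tnth b i.
have eU i : e i \in U by apply: vbasis_mem; exact: mem_tnth.
have eE y : y \in U -> y = \sum_i coord b i y *: e i.
  move=> /coord_vbasis {1}->; apply: eq_bigr => i _; congr (_ *: _).
  by rewrite /e (tnth_nth 0).
pose G : 'M[R]_d := \matrix_(i, j) sp (e i) (e j).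
pose comb (c : 'rV[R]_d) := \sum_i c 0 i *: e i.
have combU c : comb c \in U by apply: memv_suml => i _; exact: memvZ.
have combG c j : sp (comb c) (e j) = (c *m G) 0 j.
  rewrite (functional_comb _ _ _ (sp_lin (e j))) !mxE.
  by apply: eq_bigr => i _; rewrite mxE.
have sp_comb c y : y \in U -> sp (comb c) y = \sum_j coord b j y * (c *m G) 0 j.
  move=> /eE {1}->; rewrite (functional_comb _ _ _ (sp_linr (comb c))).
  by apply: eq_bigr => j _; rewrite combG.
have G_unit : G \in unitmx.
  rewrite -row_free_unit; apply: inj_row_free => c cG0.
  have c0 : comb c = 0.
    apply: ndU => // y yU; rewrite sp_comb// cG0.
    by rewrite big1// => j _; rewrite mxE mulr0.
  have /freeP fb := basis_free (vbasisP U).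
  apply/rowP => i; rewrite mxE; apply: (fb (fun i => c 0 i)).
  by rewrite -[RHS]c0; apply: eq_bigr => j _; rewrite /e (tnth_nth 0).
pose t := \row_j f (e j).
exists (comb (t *m invmx G)) => // y yU.
rewrite sp_comb// mulmxKV// {2}(eE y yU) (functional_comb _ _ _ f_lin).
by apply: eq_bigr => j _; rewrite mxE.
Qed.

Lemma orth_proj U x : is_nondegenerate sp U ->
  exists2 u, u \in U & forall y, y \in U -> sp (x - u) y = 0.
Proof.
move=> ndU; have [u uU xu] := riesz ndU (sp_linr x).
by exists u => // y yU; rewrite spBl xu// subrr.
Qed.

(** A vector orthogonal to the complement of [U] in [V] lies in [U]: its
   component orthogonal to [U] is orthogonal to all of [V]. *)
Lemma orth_orth U V x : (U <= V)%VS -> is_nondegenerate sp U ->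
  is_nondegenerate sp V -> x \in V ->
  (forall w, w \in V -> (forall y, y \in U -> sp w y = 0) -> sp x w = 0) ->
  x \in U.
Proof.
move=> UV ndU ndV xV xW; have [u uU xu] := orth_proj x ndU.
have uV : u \in V by exact: subvP uU.
have xuV : x - u \in V by rewrite rpredB.
suff /eqP : x - u = 0 by rewrite subr_eq0 => /eqP ->.
apply: ndV => // y yV; have [y' y'U yy'] := orth_proj y ndU.
have wV : y - y' \in V by rewrite rpredB//; exact: subvP y'U.
rewrite -(subrK y' y) spDr (xu y')// addr0 spBl xW//.
by rewrite spC yy'// subr0.
Qed.

(** The dual basis expresses coordinates as scalar products, which makes the
   coordinates of a smooth vector field smooth. *)
Lemma dual_frame : is_nondegenerate sp fullv ->
  exists (k : nat) (e e' : 'I_k -> n), forall x, x = \sum_i sp x (e' i) *: e i.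
Proof.
move=> nd; pose b := vbasis (@fullv R n).
have /choice[e' e'P] (i : 'I_(\dim (@fullv R n))) :
    exists u, forall x, sp u x = coord b i x.
  have c_lin a x y : coord b i (a *: x + y) = a * coord b i x + coord b i y.
    by rewrite linearP.
  have [u _ uP] := riesz nd c_lin.
  by exists u => x; apply: uP; exact: memvf.
exists _, (fun i => b`_i), e' => x; rewrite [LHS](coord_vbasis (memvf x)).
by apply: eq_bigr => i _; rewrite spC e'P.
Qed.

Section Bracket.
Variables (br : n -> n -> n) (z v z1 z2 v1 v2 : {vspace n}) (J : n -> n -> n).
Hypothesis br_lin : forall w a x y, br (a *: x + y) w = a *: br x w + br y w.
Hypothesis brC : forall x y, br x y = - br y x.
Hypothesis br2 : forall x y w, br (br x y) w = 0.
Hypothesis z_centre : is_centre br z.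
Hypothesis z_nondeg : is_nondegenerate sp z.
Hypothesis v_orth : is_orth_in sp fullv z v.
Hypothesis J_def : is_J br sp z v J.
Hypothesis z1_sub : (z1 <= z)%VS.
Hypothesis v1_sub : (v1 <= v)%VS.
Hypothesis z1_nondeg : is_nondegenerate sp z1.
Hypothesis v1_nondeg : is_nondegenerate sp v1.
Hypothesis z2_orth : is_orth_in sp z z1 z2.
Hypothesis v2_orth : is_orth_in sp v v1 v2.

Let brDl x y w : br (x + y) w = br x w + br y w.
Proof. by have := br_lin w 1 x y; rewrite !scale1r. Qed.

Let brzl c w : c \in z -> br c w = 0.
Proof. by move=> /z_centre ->. Qed.

Let brzr c w : c \in z -> br w c = 0.
Proof. by move=> cz; rewrite brC brzl// oppr0. Qed.

Let brDr w x y : br w (x + y) = br w x + br w y.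
Proof. by rewrite brC brDl opprD -!(brC w). Qed.

Let br_z x y : br x y \in z.
Proof. by apply/z_centre => w; exact: br2. Qed.

Let sp_zv c x : c \in z -> x \in v -> sp c x = 0.
Proof. by move=> cz /v_orth[_ /(_ c cz)]; rewrite spC. Qed.

(** Modulo the centre the bracket is that of [v1]-components; it lies in [z1]
   because <[x, y], c> = <J_c x, y> vanishes for [c] in [z2]. *)
Lemma subalgebra_sum : (forall c x, c \in z2 -> x \in v1 -> J c x \in v2) ->
  is_lie_subalgebra br (z1 + v1)%VS.
Proof.
move=> Jz2 _ _ /memv_addP[a az1 [x xv1 ->]] /memv_addP[b bz1 [y yv1 ->]].
have az : a \in z by exact: subvP az1.
have bz : b \in z by exact: subvP bz1.
have xv : x \in v by exact: subvP xv1.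
have yv : y \in v by exact: subvP yv1.
rewrite brDl brzl// add0r brDr brzr// add0r.
apply: (subvP (addvSl z1 v1)); apply: orth_orth z1_sub _ _ _ _ => // c cz cz1.
have cz2 : c \in z2 by apply/z2_orth.
have [Jv JE] := J_def cz xv; rewrite -JE//.
by have /v2_orth[_ ->] := Jz2 _ _ cz2 xv1.
Qed.

Lemma nondegenerate_sum : is_nondegenerate sp (z1 + v1)%VS.
Proof.
move=> _ /memv_addP[a az1 [x xv1 ->]] ax0.
have az : a \in z by exact: subvP az1.
have xv : x \in v by exact: subvP xv1.
have -> : a = 0.
  apply: z1_nondeg => // c cz1; have cz : c \in z by exact: subvP cz1.
  rewrite -(ax0 c) ?spDl ?(subvP (addvSl z1 v1))//.
  by rewrite (spC x) (sp_zv cz xv) addr0.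
have -> : x = 0; last by rewrite addr0.
apply: v1_nondeg => // y yv1; have yv : y \in v by exact: subvP yv1.
by rewrite -(ax0 y) ?spDl ?(subvP (addvSr z1 v1))// (sp_zv az yv) add0r.
Qed.

(** Since [br x w] is central, only the [z]-component [b] of [y] counts, and
   <[x, w], b> = <J_b x, w> where J_b x lies in [v1]. *)
Lemma bracket_orth_sum : (forall c x, c \in z1 -> x \in v1 -> J c x \in v1) ->
  forall x y w, x \in (z1 + v1)%VS -> y \in (z1 + v1)%VS ->
  (forall u, u \in (z1 + v1)%VS -> sp w u = 0) -> sp (br x w) y = 0.
Proof.
move=> Jz1 _ _ w /memv_addP[a az1 [x xv1 ->]] /memv_addP[b bz1 [y yv1 ->]] w0.
have az : a \in z by exact: subvP az1.
have bz : b \in z by exact: subvP bz1.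
have xv : x \in v by exact: subvP xv1.
have yv : y \in v by exact: subvP yv1.
have [c cz wc] := orth_proj w z_nondeg.
have wcv : w - c \in v by apply/v_orth; split=> //; exact: memvf.
rewrite spDr (sp_zv (br_z _ _) yv) addr0 brDl brzl// add0r.
rewrite -(subrK c w) brDr (brzr _ cz) addr0.
have [_ <-//] := J_def bz xv; have Jv1 := Jz1 _ _ bz1 xv1.
rewrite spC spBl w0 ?(subvP (addvSr z1 v1))//.
by rewrite (sp_zv cz) ?subr0//; exact: subvP Jv1.
Qed.

End Bracket.

End ScalarProduct.

(** * The Lie algebra and the Levi-Civita connection of left-invariant fields *)

Section LieAlgebra.
Context {R : realType} {m : nat} (N : lie_group R m) (g : bform_field N).
Context (n : vectType R) (br : n -> n -> n) (fld : n -> vfield N).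
Hypothesis n_lie : is_lie_algebra_of br fld.
Hypothesis g_metric : is_pseudo_riemannian g.
Hypothesis g_left : left_invariant_form g.

Local Notation sp := (scalar_product g fld).

Lemma left_invariant_fld x : left_invariant (fld x).
Proof. by apply/(la_left_invariant n_lie); exists x. Qed.

Lemma smooth_fld x : smooth_vfield (fld x).
Proof. by have [] := left_invariant_fld x. Qed.

Lemma fld_at p u : exists x, fld x p = u.
Proof.
have [X /(la_left_invariant n_lie)[x <-] Xp] := left_invariant_at p u.
by exists x.
Qed.

Lemma fld0 p : fld 0 p = 0.
Proof.
have := la_linear n_lie 1 0 0 p.
by rewrite scaler0 addr0 scale1r -[LHS]addr0 => /addrI.
Qed.

Lemma fld_comb I (r : seq I) (c : I -> R) (e : I -> n) p :
  fld (\sum_(i <- r) c i *: e i) p = \sum_(i <- r) c i *: fld (e i) p.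
Proof.
elim: r => [|i r IH]; first by rewrite !big_nil fld0.
by rewrite !big_cons (la_linear n_lie) IH.
Qed.

Lemma br_linear w a x y : br (a *: x + y) w = a *: br x w + br y w.
Proof.
apply: (la_injective n_lie); apply: lie_bracket_unique (la_bracket n_lie _ _) _.
have E c u t : fld (c *: u + t) = (fun p => c *: fld u p + fld t p).
  by apply/funext => p; rewrite (la_linear n_lie).
rewrite !E.
apply: lie_bracket_linear (la_bracket n_lie _ _) (la_bracket n_lie _ _);
  exact: smooth_fld.
Qed.

Lemma br_antisym x y : br x y = - br y x.
Proof.
apply: (la_injective n_lie); apply: lie_bracket_unique (la_bracket n_lie _ _) _.
have -> : fld (- br y x) = (fun p => - fld (br y x) p).
  apply/funext => p; rewrite -[- br y x]addr0 -scaleN1r (la_linear n_lie).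
  by rewrite fld0 addr0 scaleN1r.
exact: lie_bracketC (la_bracket n_lie _ _).
Qed.

Lemma metric_fld p x y : g p (fld x p) (fld y p) = sp x y.
Proof.
rewrite /scalar_product -(g_left p (lone N)).
by rewrite -!left_invariant_lmul ?lmulg1//; exact: left_invariant_fld.
Qed.

Lemma sp_linear w a x y : sp (a *: x + y) w = a * sp x w + sp y w.
Proof. by rewrite /scalar_product (la_linear n_lie) (pr_linear g_metric). Qed.

Lemma sp_sym x y : sp x y = sp y x.
Proof. exact: (pr_sym g_metric). Qed.

(** The metric is non-degenerate on the tangent space at 1, which consists of
   values of left-invariant fields; one that vanishes at 1 vanishes. *)
Lemma sp_nondegenerate : is_nondegenerate sp fullv.
Proof.
move=> x _ x0; apply: (la_injective n_lie); apply/funext => p.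
rewrite fld0 (left_invariant_lmul p (left_invariant_fld x)).
suff -> : fld x (lone N) = 0 by rewrite tangent_map0.
apply: (pr_nondeg g_metric) => u; have [y <-] := fld_at (lone N) u.
by apply: x0; exact: memvf.
Qed.

Section LeviCivita.
Variable nabla : vfield N -> vfield N -> vfield N.
Hypothesis LC : is_levi_civita g nabla.

Lemma nabla0l Y : smooth_vfield Y -> nabla (fun=> 0) Y = (fun=> 0).
Proof.
move=> sY; have s0 := @smooth_vfield0 R m N.
have := lc_tensorial LC (smooth_fun_cst [set: N] 1) s0 s0 sY.
rewrite scaler0 addr0 => E; apply/funext => p.
have := congr1 (fun X : vfield N => X p) E.
by rewrite /= scale1r -[LHS]addr0 => /addrI.
Qed.

Lemma nabla_suml I (r : seq I) (f : I -> N -> R) (X : I -> vfield N) Y :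
  (forall i, smooth_fun [set: N] (f i)) -> (forall i, smooth_vfield (X i)) ->
  smooth_vfield Y ->
  smooth_vfield (fun p => \sum_(i <- r) f i p *: X i p) /\
  nabla (fun p => \sum_(i <- r) f i p *: X i p) Y =
    (fun p => \sum_(i <- r) f i p *: nabla (X i) Y p).
Proof.
move=> sf sX sY; elim: r => [|i r [sS nS]].
  have E (F : I -> N -> 'rV[R]_m) : (fun p => \sum_(i <- [::]) F i p) = (fun=> 0).
    by apply/funext => p; rewrite big_nil.
  by rewrite !E nabla0l//; split => //; exact: smooth_vfield0.
have E (F : I -> N -> 'rV[R]_m) : (fun p => \sum_(j <- i :: r) F j p) =
    (fun p => F i p + \sum_(j <- r) F j p).
  by apply/funext => p; rewrite big_cons.
rewrite !E (lc_tensorial LC (sf i) (sX i) sS sY) nS; split => //.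
exact: smooth_vfieldD_scale.
Qed.

(** The fields are expanded in a global left-invariant frame, with smooth
   coefficients given by the metric; linearity over functions then leaves only
   the values of the coefficients at [p]. *)
Lemma nabla_pointwise X X' Y p :
  smooth_vfield X -> smooth_vfield X' -> smooth_vfield Y ->
  X p = X' p -> nabla X Y p = nabla X' Y p.
Proof.
move=> sX sX' sY XX'.
have [k [e [e' frame]]] := dual_frame sp_linear sp_sym sp_nondegenerate.
pose f (X : vfield N) i q := g q (X q) (fld (e' i) q).
have sf Z i : smooth_vfield Z -> smooth_fun [set: N] (f Z i).
  by move=> sZ; apply: (pr_smooth g_metric) => //; exact: smooth_fld.
have expand Z : Z = (fun q => \sum_i f Z i q *: fld (e i) q).
  apply/funext => q; have [x xq] := fld_at q (Z q).
  rewrite -xq {1}(frame x) fld_comb; apply: eq_bigr => i _.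
  by rewrite /f -xq metric_fld.
have nablaE Z : smooth_vfield Z ->
    nabla Z Y p = \sum_i f Z i p *: nabla (fld (e i)) Y p.
  move=> sZ; rewrite {1}(expand Z).
  have [||//|_ ->//] :=
      @nabla_suml _ (index_enum 'I_k) (f Z) (fun i => fld (e i)) Y.
    by move=> i; exact: sf.
  by move=> i; exact: smooth_fld.
by rewrite !nablaE//; apply: eq_bigr => i _; rewrite /f XX'.
Qed.

(** Koszul's formula; the products of the three fields being constant, only the
   bracket terms remain. *)
Lemma koszul x y w p :
  2 * g p (nabla (fld x) (fld y) p) (fld w p) =
  sp (br x y) w - sp (br y w) x + sp (br w x) y.
Proof.
pose T x y w := g p (nabla (fld x) (fld y) p) (fld w p).
have metric a b c : T a b c = - T a c b.
  have := lc_metric LC (smooth_fld a) (smooth_fld b) (smooth_fld c) p.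
  have -> : (fun q => g q (fld b q) (fld c q)) = (fun=> sp b c).
    by apply/funext => q; exact: metric_fld.
  rewrite vact_cst (pr_sym g_metric _ (fld b p)) => /esym/eqP.
  by rewrite addr_eq0 => /eqP.
have torsion a b c : T a b c - T b a c = sp (br a b) c.
  rewrite -(metric_fld p (br a b)).
  have := lc_torsion_free LC (smooth_fld a) (smooth_fld b).
  move=> /(lie_bracket_unique (la_bracket n_lie a b)) ->.
  have gB u u' t : g p (u - u') t = g p u t - g p u' t.
    by rewrite addrC -scaleN1r (pr_linear g_metric) mulN1r addrC.
  by rewrite gB.
rewrite -!torsion -/(T x y w) (metric y w x) (metric w y x) (metric x w y).
lra.
Qed.

End LeviCivita.

End LieAlgebra.

(** * Totally geodesic subgroups *)

(** Tangent vectors of the subgroup extend to left-invariant fields, whose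
   images under the homomorphism are restrictions of left-invariant fields of
   the ambient group. *)
Lemma subgroup_tangent (R : realType) (m m1 : nat) (N : lie_group R m)
    (n : vectType R) (br : n -> n -> n) (fld : n -> vfield N) (n1 : {vspace n})
    (H : lie_group R m1) (iota : H -> N) :
  is_lie_algebra_of br fld -> is_lie_subgroup_of_algebra fld n1 iota ->
  forall q (w : 'rV[R]_m),
    (exists u, w = tangent_map iota q u) <->
    (exists2 x, x \in n1 & fld x (iota q) = w).
Proof.
move=> n_lie sub q w; split=> [[u ->]|[x /(ls_algebra sub)[Y _ YE] <-]]; last first.
  by exists (Y q); rewrite YE.
have [Y Y_inv <-] := left_invariant_at q u.
have [x xE] :=
  fld_at n_lie (iota (lone H)) (tangent_map iota (lone H) (Y (lone H))).
have iota_diff p : mdifferentiable iota p.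
  by apply: smooth_map_mdifferentiable; have [] := ls_immersion sub.
(* the two fields are related at 1, hence everywhere by left translation *)
have relE p : tangent_map iota p (Y p) = fld x (iota p).
  rewrite (left_invariant_lmul p Y_inv) -{1}[p]lmulg1.
  have L : mdifferentiable (lmul p) (lone H) by exact: mdifferentiable_lmul.
  rewrite -(tangent_map_comp _ L (iota_diff _)).
  have -> : iota \o lmul p = lmul (iota p) \o iota.
    by apply/funext => r; rewrite /= (ls_morph sub).
  rewrite (tangent_map_comp _ (iota_diff _) (mdifferentiable_lmul _ _)) -xE.
  have [_ ->] := left_invariant_fld n_lie x.
  by rewrite -(ls_morph sub) lmulg1.
by exists x => //; apply/(ls_algebra sub); exists Y.
Qed.

(** The normal part of nabla_X Y is tested against the left-invariant fields of
   vectors [w] orthogonal to [n1].  Differentiating <Y, W> = 0 moves the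
   derivative from Y to W, and nabla_X W only sees the value of X at the point,
   so X and Y may be taken left-invariant; Koszul's formula then gives zero. *)
Lemma totally_geodesic_subgroup (R : realType) (m m1 : nat) (N : lie_group R m)
    (g : bform_field N) (n : vectType R) (br : n -> n -> n)
    (fld : n -> vfield N) (n1 : {vspace n}) (H : lie_group R m1)
    (iota : H -> N) :
  is_lie_algebra_of br fld -> is_pseudo_riemannian g ->
  left_invariant_form g -> is_lie_subgroup_of_algebra fld n1 iota ->
  is_nondegenerate (scalar_product g fld) n1 -> is_lie_subalgebra br n1 ->
  (forall x y w, x \in n1 -> y \in n1 ->
    (forall u, u \in n1 -> scalar_product g fld w u = 0) ->
    scalar_product g fld (br x w) y = 0) ->
  totally_geodesic iota g.
Proof.
move=> n_lie g_metric g_left sub nd1 sub1 orth.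
have tangP := subgroup_tangent n_lie sub.
have metE := metric_fld n_lie g_left.
have spC := sp_sym fld g_metric.
split; first exact: ls_immersion sub.
- move=> q u u0; have [x xn1 xE] := (tangP q _).1 (ex_intro _ u erefl).
  suff x0 : x = 0.
    have [_ /(_ q) inj] := ls_immersion sub; apply: inj.
    by rewrite -xE x0 (fld0 n_lie) tangent_map0.
  apply: nd1 => // y yn1.
  have [v vE] := (tangP q _).2 (ex_intro2 _ _ y yn1 erefl).
  by rewrite -(metE (iota q)) vE xE; exact: u0.
move=> nabla LC V X Y oV sX sY tX tY q Vq; apply/tangP.
have [t tE] := fld_at n_lie (iota q) (nabla X Y (iota q)).
exists t => //.
have nd := sp_nondegenerate n_lie g_metric.
apply: (orth_orth (sp_linear n_lie g_metric) spC (subvf _) nd1 nd).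
  exact: memvf.
move=> w _ w0; rewrite -(metE (iota q)) tE.
have [x xn1 xE] := (tangP q _).1 (tX q Vq).
have [y yn1 yE] := (tangP q _).1 (tY q Vq).
have sW := smooth_fld n_lie w.
have [u XE] := tX q Vq.
have iota_diff : mdifferentiable iota q.
  by apply: smooth_map_mdifferentiable; have [] := ls_immersion sub.
(* <Y, W> vanishes along the sheet, hence so does its derivative along X *)
have := lc_metric LC sX sY sW (iota q).
rewrite (vact_comp_eq0 iota_diff _ oV Vq _ XE); first last.
- move=> r Vr; have [y' y'n1 <-] := (tangP r _).1 (tY r Vr).
  by rewrite metE spC w0.
- exact: (pr_smooth g_metric).
have sx := smooth_fld n_lie x.
rewrite (nabla_pointwise n_lie g_metric g_left LC sX sx sW (esym xE)).
rewrite -yE (pr_sym g_metric _ (fld y _)).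
have := koszul n_lie g_metric g_left LC x w y (iota q).
rewrite (br_antisym n_lie w y) (spNl (sp_linear n_lie g_metric)).
rewrite (orth y x w)// (orth x y w)// spC w0 ?sub1//.
lra.
Qed.
Theorem theorem5 (R : realType) (m : nat) (N : lie_group R m)
    (g : bform_field N)
    (n : vectType R) (br : n -> n -> n) (fld : n -> vfield N)
    (z v z1 z2 v1 v2 : {vspace n}) (J : n -> n -> n)
    (N_connected : connected [set: N])
    (n_lie : is_lie_algebra_of br fld)
    (n_nil : two_step_nilpotent br)
    (g_metric : is_pseudo_riemannian g)
    (g_left : left_invariant_form g)
    (z_centre : is_centre br z)
    (z_nondeg : is_nondegenerate (scalar_product g fld) z)
    (v_orth : is_orth_in (scalar_product g fld) fullv z v)
    (J_def : is_J br (scalar_product g fld) z v J)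
    (z1_sub : (z1 <= z)%VS)
    (v1_sub : (v1 <= v)%VS)
    (z1_nondeg : is_nondegenerate (scalar_product g fld) z1)
    (v1_nondeg : is_nondegenerate (scalar_product g fld) v1)
    (z2_orth : is_orth_in (scalar_product g fld) z z1 z2)
    (v2_orth : is_orth_in (scalar_product g fld) v v1 v2) :
  ((forall c x, c \in z2 -> x \in v1 -> J c x \in v2) ->
     is_lie_subalgebra br (z1 + v1)%VS)
  /\
  ((forall c x, c \in z2 -> x \in v1 -> J c x \in v2) ->
   (forall c x, c \in z1 -> x \in v1 -> J c x \in v1) ->
     forall (m1 : nat) (N1 : lie_group R m1) (iota : N1 -> N),
       is_lie_subgroup_of_algebra fld (z1 + v1)%VS iota ->
       totally_geodesic iota g).

Proof.
have sp_lin := sp_linear n_lie g_metric.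
have spC := sp_sym fld g_metric.
have br_lin := br_linear n_lie.
have brC := br_antisym n_lie.
have [_ br2] := n_nil.
have subalgebra := subalgebra_sum sp_lin spC br_lin brC br2 z_centre z_nondeg
  J_def z1_sub v1_sub z1_nondeg z2_orth v2_orth.
split=> // Jz2 Jz1 m1 N1 iota sub.
apply: (totally_geodesic_subgroup n_lie g_metric g_left sub).
- exact: (nondegenerate_sum sp_lin spC v_orth z1_sub v1_sub z1_nondeg v1_nondeg).
- exact: subalgebra.
- exact: (bracket_orth_sum sp_lin spC br_lin brC br2 z_centre z_nondeg v_orth
    J_def z1_sub v1_sub Jz1).
Qed.
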